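(* Let $I=[a,b]$ with $a<b$, let $J\subseteq\mathbb{R}$ with $[0,1]\subseteq J$, let $h:J\to\mathbb{R}$ be a nonnegative function, and let $f,g:I\to(0,\infty)$ be $h$-logarithmically convex functions. Then for all $\alpha,\beta>0$ with $\alpha+\beta=1$, $$\frac{1}{b-a}\int_a^b (fg)(x)\,dx\le \int_0^1\left[\alpha\left\{[f(a)]^{h(t)}[f(b)]^{h(1-t)}\right\}^{\frac1\alpha}+\beta\left\{[g(a)]^{h(t)}[g(b)]^{h(1-t)}\right\}^{\frac1\beta}\right]dt$$ and $$\frac{1}{b-a}\int_a^b (fg)(x)\,dx\le \int_0^1\left\{\alpha[f(a)g(a)]^{\frac{h(t)}{\alpha}}+\beta[f(b)g(b)]^{\frac{h(1-t)}{\beta}}\right\}dt,$$ where $(fg)(x)=f(x)g(x)$.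
   Context: A positive function $f$ on a real interval $I=[a,b]$ is called $h$-logarithmically convex ($h$-$\log$-convex) if for all $x,y\in I$ and $t\in[0,1]$, $f(tx+(1-t)y)\le [f(x)]^{h(t)}[f(y)]^{h(1-t)}$, where $h:J\to\mathbb{R}$ is a nonnegative function on $J\subseteq\mathbb{R}$. *)

(* Defs.v *)
From mathcomp Require Import all_boot all_order all_algebra.
From mathcomp Require Import all_classical all_reals all_analysis.

Set Implicit Arguments.
Unset Strict Implicit.
Unset Printing Implicit Defensive.

Import Order.TTheory GRing.Theory Num.Theory.
Local Open Scope classical_set_scope.
Local Open Scope ring_scope.

(* h and f are total functions on R standing for functions on J and I: when I
   is an interval, only the values of f on I and of h on [0, 1] matter. *)
Definition h_log_convex (R : realType) (h : R -> R) (I : set R) (f : R -> R)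
    : Prop :=
  (forall x, I x -> 0 < f x) /\
  (forall x y t, I x -> I y -> 0 <= t <= 1 ->
     f (t * x + (1 - t) * y) <= f x `^ h t * f y `^ h (1 - t)).

(* Main.v *)
(* Substituting x = t a + (1 - t) b turns the mean of fg over [a, b] into the
   integral over [0, 1] of f(t a + (1 - t) b) g(t a + (1 - t) b), which
   h-log-convexity bounds by f(a)^h(t) f(b)^h(1-t) g(a)^h(t) g(b)^h(1-t).
   Grouping the factors by function or by endpoint, Young's inequality
   u v <= alpha u^(1/alpha) + beta v^(1/beta) gives the two claims.
   Neither f, g nor h is assumed measurable, so the integrals are suprema over
   the simple functions below the integrands; monotonicity and the affine
   substitution (applied to those simple functions) survive in this setting,
   and additivity is never used. *)
Require Import Defs.
From mathcomp Require Import all_boot all_order all_algebra.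
From mathcomp Require Import all_classical all_reals all_analysis.
From mathcomp Require Import measurable_realfun ring lra.

Set Implicit Arguments.
Unset Strict Implicit.
Unset Printing Implicit Defensive.

Import Order.TTheory GRing.Theory Num.Theory.
Local Open Scope classical_set_scope.
Local Open Scope ring_scope.

Import HBNNSimple.

Lemma measurable_affine (R : realType) (k c : R) :
  measurable_fun [set: measurableTypeR R]
    (fun x : R => k * x + c : measurableTypeR R).
Proof. by apply: measurable_funD => //; exact: measurable_funM. Qed.

(** By uniqueness of Lebesgue measure: the pushforward under [x |-> k * x + c], scaled by [|k|],
    gives each interval []x, y]] its length. *)
Lemma lebesgue_measure_affine (R : realType) (k c : R)
    (A : set (measurableTypeR R)) :
  k != 0 -> measurable A ->
  lebesgue_measure A =
    (`|k|%:E * lebesgue_measure [set x : R | A (k * x + c)%R])%E.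
Proof.
move=> k0 mA.
have nk0 : 0 <= `|k| by [].
pose phi (x : measurableTypeR R) : measurableTypeR R := k * x + c.
(* [m] is a function of the measurability proof of [phi]. *)
pose m : {measure set (measurableTypeR R) -> \bar R} :=
  mscale (NngNum nk0) (pushforward lebesgue_measure phi).
rewrite (lebesgue_measure_unique (mu := m (measurable_affine k c)))// => _ [[x y] xy <-].
rewrite /m /= /mscale/= /pushforward lebesgue_measure_itv/= lte_fin.
case: (ltgtP k 0) k0 => // k0 _.
(* A negative slope reverses the order, so the preimage is closed on the left and open on the
   right. *)
- have -> : phi @^-1` `]x, y] = `[(y - c) / k, (x - c) / k[%classic.
    apply/seteqP; split => z /=; rewrite !in_itv/= /phi.
      by rewrite ler_ndivrMr// ltr_ndivlMr// => /andP[? ?]; apply/andP; split; lra.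
    by rewrite ler_ndivrMr// ltr_ndivlMr// => /andP[? ?]; apply/andP; split; lra.
  rewrite lebesgue_measure_itv/= lte_fin ltr_nM2r ?invr_lt0// ltrD2r.
  case: ifPn => _; last by rewrite mule0.
  by rewrite -!EFinB -EFinM ltr0_norm//; congr EFin; field; rewrite lt_eqF.
- have -> : phi @^-1` `]x, y] = `](x - c) / k, (y - c) / k]%classic.
    apply/seteqP; split => z /=; rewrite !in_itv/= /phi.
      by rewrite ltr_pdivrMr// ler_pdivlMr// => /andP[? ?]; apply/andP; split; lra.
    by rewrite ltr_pdivrMr// ler_pdivlMr// => /andP[? ?]; apply/andP; split; lra.
  rewrite lebesgue_measure_itv/= lte_fin ltr_pM2r ?invr_gt0// ltrD2r.
  case: ifPn => _; last by rewrite mule0.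
  by rewrite -!EFinB -EFinM gtr0_norm//; congr EFin; field; rewrite gt_eqF.
Qed.

Lemma ge0_integral_affine (R : realType) (k c : R) (F : R -> \bar R) :
  k != 0 -> measurable_fun [set: measurableTypeR R] F ->
  (forall x, (0 <= F x)%E) ->
  (\int[lebesgue_measure]_x F x =
    `|k|%:E * \int[@lebesgue_measure R]_x F (k * x + c)%R)%E.
Proof.
move=> k0 mF F0.
have nk0 : 0 <= `|k| by [].
pose phi (x : measurableTypeR R) : measurableTypeR R := k * x + c.
pose m : {measure set (measurableTypeR R) -> \bar R} :=
  mscale (NngNum nk0) (pushforward lebesgue_measure phi).
rewrite (@eq_measure_integral _ _ _ _ (m (measurable_affine k c))) => [|A mA _].
  rewrite /m ge0_integral_mscale//= ge0_integral_pushforward//.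
  exact: measurable_affine.
exact: lebesgue_measure_affine.
Qed.

(* [ge0_le_integral] without its measurability hypotheses. *)
Lemma ge0_le_integral_sup d (T : measurableType d) (R : realType)
    (mu : {measure set T -> \bar R}) (D : set T) (F G : T -> \bar R) :
  (forall x, D x -> (0 <= F x)%E) -> (forall x, D x -> (F x <= G x)%E) ->
  (\int[mu]_(x in D) F x <= \int[mu]_(x in D) G x)%E.
Proof.
move=> F0 FG.
have G0 x : D x -> (0 <= G x)%E by move=> Dx; exact: le_trans (F0 x Dx) (FG x Dx).
rewrite !ge0_integralE//; apply: le_ereal_sup => _ [s /= sF <-].
by exists s => // x; apply: le_trans (sF x) _; exact: lee_restrict.
Qed.

(** Each simple [s] below [F] on [D] is measurable, so the exact substitution applies to it, and
    [s (k * x + c)] stays below the substituted integrand. The supremum over [s] then gives this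
    direction for arbitrary [F]. *)
Lemma ge0_integral_affine_le (R : realType) (k c : R) (D : set R)
    (F : R -> \bar R) :
  k != 0 -> (forall x, D x -> (0 <= F x)%E) ->
  (\int[@lebesgue_measure R]_(x in D) F x <=
    `|k|%:E * \int[@lebesgue_measure R]_(x in [set x | D (k * x + c)%R])
                F (k * x + c)%R)%E.
Proof.
move=> k0 F0; rewrite [leLHS]ge0_integralE//.
apply: ge_ereal_sup => _ [s /= sF <-].
have -> : sintegral (@lebesgue_measure R) s =
    (\int[@lebesgue_measure R]_x (s x)%:E)%E.
  by rewrite integral_nnsfun// patch_setT.
rewrite (ge0_integral_affine c k0); last 2 first.
  exact/measurable_EFinP.
  by move=> x; rewrite lee_fin.
rewrite lee_wpmul2l//; rewrite [leRHS]integral_mkcond.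
apply: ge0_le_integral_sup => x _; first by rewrite lee_fin.
by apply: le_trans (sF _) _; rewrite /patch.
Qed.

Lemma weighted_AM_GM_powR (R : realType) (u v alpha beta : R) :
  0 <= u -> 0 <= v -> 0 < alpha -> 0 < beta -> alpha + beta = 1 ->
  u * v <= alpha * u `^ (1 / alpha) + beta * v `^ (1 / beta).
Proof.
move=> u0 v0 al0 be0 ab1.
(* The conjugate exponents are [alpha^-1] and [beta^-1]; each weight is written as the inverse of
   its exponent. *)
rewrite !div1r [alpha * _]mulrC [beta * _]mulrC -{2}[alpha]invrK -{2}[beta]invrK.
by apply: conjugate_powR; rewrite ?invr_gt0// !invrK.
Qed.

(** The substitution has slope [a - b] and offset [b], sending 0 to [b] and 1 to [a]; its factor
    [|a - b|] cancels [1 / (b - a)]. *)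
Lemma le_integral_unit_segment (R : realType) (a b : R) (F G : R -> R) :
  a < b -> (forall x, x \in `[a, b] -> 0 <= F x) ->
  (forall t, 0 <= t <= 1 -> F (t * a + (1 - t) * b) <= G t) ->
  ((1 / (b - a))%:E * \int[@lebesgue_measure R]_(x in `[a, b]) (F x)%:E
    <= \int[@lebesgue_measure R]_(t in `[0%R, 1%R]) (G t)%:E)%E.
Proof.
move=> ab F0 FG.
have phiE t : (a - b) * t + b = t * a + (1 - t) * b by ring.
have ba0 : 0 < b - a by rewrite subr_gt0.
have D01 : [set x | `[a, b]%classic ((a - b) * x + b)] = `[0, 1]%classic.
  by apply/seteqP; split => t /=; rewrite !in_itv/= => /andP[? ?];
    apply/andP; split; nra.
have ab0 : a - b != 0 by rewrite lt_eqF// subr_lt0.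
have := @ge0_integral_affine_le R (a - b) b `[a, b] (EFin \o F) ab0
  (fun x xab => F0 x xab).
rewrite D01 distrC gtr0_norm// => /le_trans le1.
rewrite div1r lee_pdivrMl//; apply: le1; rewrite lee_wpmul2l ?lee_fin ?(ltW ba0)//.
apply: ge0_le_integral_sup => t t01.
  by rewrite lee_fin; apply: F0; rewrite -D01 in t01.
by rewrite lee_fin phiE FG//; move: t01; rewrite /= in_itv.
Qed.

Theorem theorem3 (R : realType) (a b : R) (hab : a < b)
    (J : set R) (h01J : `[0, 1] `<=` J)
    (h : R -> R) (h_ge0 : forall t, J t -> 0 <= h t)
    (f g : R -> R)
    (hf : h_log_convex h `[a, b] f) (hg : h_log_convex h `[a, b] g)
    (alpha beta : R) (halpha : 0 < alpha) (hbeta : 0 < beta)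
    (hab1 : alpha + beta = 1) :
  (((1 / (b - a))%:E *
      \int[@lebesgue_measure R]_(x in `[a, b]) (f x * g x)%:E
    <= \int[@lebesgue_measure R]_(t in `[0%R, 1%R])
         (alpha * (f a `^ h t * f b `^ h (1 - t)) `^ (1 / alpha)
          + beta * (g a `^ h t * g b `^ h (1 - t)) `^ (1 / beta))%:E)%E)
  /\
  (((1 / (b - a))%:E *
      \int[@lebesgue_measure R]_(x in `[a, b]) (f x * g x)%:E
    <= \int[@lebesgue_measure R]_(t in `[0%R, 1%R])
         (alpha * (f a * g a) `^ (h t / alpha)
          + beta * (f b * g b) `^ (h (1 - t) / beta))%:E)%E).
Proof.
have [[f0 fle] [g0 gle]] := (hf, hg).
have aab : `[a, b]%classic a by rewrite /= in_itv/= lexx ltW.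
have bab : `[a, b]%classic b by rewrite /= in_itv/= lexx ltW.
have [[[fa0 fb0] ga0] gb0] := (f0 _ aab, f0 _ bab, g0 _ aab, g0 _ bab).
have fg0 x : x \in `[a, b] -> 0 <= f x * g x.
  by move=> xab; rewrite mulr_ge0 ?ltW ?f0 ?g0.
have fgle t : 0 <= t <= 1 ->
    f (t * a + (1 - t) * b) * g (t * a + (1 - t) * b) <=
    (f a `^ h t * f b `^ h (1 - t)) * (g a `^ h t * g b `^ h (1 - t)).
  move=> t01.
  have ab_t : `[a, b]%classic (t * a + (1 - t) * b).
    by rewrite /= in_itv/=; move/andP: t01 => [? ?]; apply/andP; split; nra.
  by apply: ler_pM; rewrite ?fle ?gle// ltW ?f0 ?g0.
split; apply: (le_integral_unit_segment hab fg0) => t t01;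
    apply: le_trans (fgle t t01) _.
  by apply: weighted_AM_GM_powR; rewrite ?mulr_ge0 ?powR_ge0.
(* Second claim: the factors are regrouped by endpoint, and [h t / alpha] is split as
   [h t * (1 / alpha)] to expose the outer power in Young's inequality. *)
rewrite mulrACA -!powRM; try exact: ltW.
rewrite -[alpha^-1]div1r -[beta^-1]div1r (powRrM _ (h t)) (powRrM _ (h (1 - t))).
by apply: weighted_AM_GM_powR; rewrite ?powR_ge0.
Qed.
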